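(* Let $I=[a,b]\subset\mathbb{R}$, let $\varphi:I\to I$, and let $f:I\to[0,\infty)$ be a $\varphi$-Godunova-Levin function. Then: (i) if $\varphi$ is linear, then $f\circ\varphi$ belongs to $Q(I)$; (ii) if $f$ is increasing and $\varphi$ is convex, then $f\circ\varphi\in Q(I)$.
   Context: A function $f:I\to[0,\infty)$ is a $\varphi$-Godunova-Levin function if $f(t\varphi(x)+(1-t)\varphi(y))\le \frac{f(\varphi(x))}{t}+\frac{f(\varphi(y))}{1-t}$ for all $x,y\in I$ and $t\in(0,1)$. $Q(I)$ is the class of (Godunova-Levin) functions $g:I\to[0,\infty)$ with $g(\lambda x+(1-\lambda)y)\le\frac{g(x)}{\lambda}+\frac{g(y)}{1-\lambda}$ for all $x,y\in I$ and $\lambda\in(0,1)$. ''$\varphi$ is linear'' means $\varphi(\lambda x+(1-\lambda)y)=\lambda\varphi(x)+(1-\lambda)\varphi(y)$ for all $x,y\in I$, $\lambda\in[0,1]$. ''Increasing'' means $u\le v$ implies $f(u)\le f(v)$. *)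

(* Defs.v *)
From mathcomp Require Import all_boot all_order all_algebra.
From mathcomp Require Import all_classical all_reals all_analysis.

Set Implicit Arguments.
Unset Strict Implicit.
Unset Printing Implicit Defensive.

Import Order.TTheory GRing.Theory Num.Theory.
Local Open Scope classical_set_scope.
Local Open Scope ring_scope.

(* A function I -> J is represented by a total function R -> R mapping I into
   J ([set_fun I J]); its values outside I are irrelevant. *)

Definition godunova_levin (R : realType) (I : set R) : set (R -> R) :=
  [set g | set_fun I `[0, +oo[ g /\
    forall x y l : R, I x -> I y -> 0 < l < 1 ->
      g (l * x + (1 - l) * y) <= g x / l + g y / (1 - l)].

Definition phi_godunova_levin (R : realType) (I : set R) (phi f : R -> R) :=
  set_fun I `[0, +oo[ f /\
    forall x y t : R, I x -> I y -> 0 < t < 1 ->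
      f (t * phi x + (1 - t) * phi y) <= f (phi x) / t + f (phi y) / (1 - t).

(* Affine on I: unlike [linear], no condition at the origin. *)
Definition linear_on (R : realType) (I : set R) (phi : R -> R) :=
  forall x y l : R, I x -> I y -> 0 <= l <= 1 ->
    phi (l * x + (1 - l) * y) = l * phi x + (1 - l) * phi y.

(* Nondecreasing, not necessarily strictly increasing. *)
Definition increasing_on (R : realType) (I : set R) (f : R -> R) :=
  forall u v : R, I u -> I v -> u <= v -> f u <= f v.

(* Main.v *)
Require Import Defs.
From mathcomp Require Import all_boot all_order all_algebra.
From mathcomp Require Import all_classical all_reals all_analysis.
From mathcomp Require Import lra.
Import Order.TTheory GRing.Theory Num.Theory.
Local Open Scope classical_set_scope.
Local Open Scope ring_scope.

(** The hypothesis on [f] already bounds [f (t * phi x + (1 - t) * phi y)] by the required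
    right-hand side, so it suffices to dominate [f (phi (t * x + (1 - t) * y))] by that value, which
    is the reduction [godunova_levin_comp]. For affine [phi] the two are equal; for convex [phi] the
    arguments are ordered and monotonicity of [f] concludes. *)

Lemma itvcc_combination (R : realFieldType) (a b x y t : R) :
  x \in `[a, b] -> y \in `[a, b] -> 0 <= t <= 1 ->
  t * x + (1 - t) * y \in `[a, b].
Proof.
rewrite !in_itv/= => /andP[ax xb] /andP[ay yb] /andP[t0 t1].
(* Each bound is a sum of products such as [t * (x - a) >= 0] and [(1 - t) * (y - a) >= 0]. *)
by apply/andP; split; nra.
Qed.

(** On [R^o] the abstract convex combination with a bundled weight in [0, 1] unfolds to the usual
    formula. *)
Lemma convex_functionE (R : realFieldType) (D : set R) (phi : R -> R)
    (x y t : R) :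
  convex_function (D : set R^o) phi -> D x -> D y -> 0 <= t <= 1 ->
  phi (t * x + (1 - t) * y) <= t * phi x + (1 - t) * phi y.
Proof.
move=> phi_cvx Dx Dy /andP[t0 t1].
exact: (phi_cvx (Itv01 t0 t1) x y (mem_set Dx) (mem_set Dy)).
Qed.

Lemma godunova_levin_comp (R : realType) (I : set R) (phi f : R -> R) :
  set_fun I I phi -> phi_godunova_levin I phi f ->
  (forall x y t : R, I x -> I y -> 0 < t < 1 ->
    f (phi (t * x + (1 - t) * y)) <= f (t * phi x + (1 - t) * phi y)) ->
  godunova_levin I (f \o phi).
Proof.
move=> phiI [f_ge0 f_GL] f_phi; split=> [x Ix | x y t Ix Iy t01] /=.
  exact/f_ge0/phiI.
exact: le_trans (f_phi _ _ _ Ix Iy t01) (f_GL _ _ _ Ix Iy t01).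
Qed.

Theorem theorem3 (R : realType) (a b : R) (phi f : R -> R)
  (hphi : set_fun `[a, b] `[a, b] phi)
  (hf : phi_godunova_levin `[a, b] phi f) :
  (linear_on `[a, b] phi -> godunova_levin `[a, b] (f \o phi)) /\
  (increasing_on `[a, b] f -> convex_function (`[a, b] : set R^o) phi ->
    godunova_levin `[a, b] (f \o phi)).
Proof.
have weak (t : R) : 0 < t < 1 -> 0 <= t <= 1.
  by case/andP=> t0 t1; rewrite !ltW.
split=> [phi_lin | f_incr phi_cvx];
    apply: godunova_levin_comp => // x y t Ix Iy /weak t01.
  by rewrite phi_lin.
(* Monotonicity holds only on [[a, b]], so both arguments must be shown to lie there: the image of a
   combination, then a combination of images. *)
apply: f_incr.
- exact/hphi/itvcc_combination.
- by apply: itvcc_combination => //; exact: hphi.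
- exact: convex_functionE phi_cvx Ix Iy t01.
Qed.
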